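(* Let $p\in\mathbb{R}[x_1,\dots,x_n]$ be a convex cover polynomial, and let $F_1,\dots,F_u$ be pairwise disjoint faces of $N(p)$ with $S(p)\subseteq\bigcup_{i=1}^u F_i$. Let $p_i=\mathrm{Proj}(p,F_i)$ for $i=1,\dots,u$. Then $p$ is SOS if and only if $p_i$ is SOS for every $i=1,\dots,u$.
   Context: Polynomials have real coefficients. A polynomial $p\in\mathbb{R}[x_1,\dots,x_n]$ is SOS if $p=\sum_{i=1}^s q_i^2$ for some finitely many $q_1,\dots,q_s\in\mathbb{R}[x_1,\dots,x_n]$. Let $\mathbb{Z}_+$ denote the set of non-negative integers. For $p=\sum_{\alpha} c_\alpha x^\alpha$ the support $S(p)\subseteq\mathbb{Z}_+^n$ is the set of exponent vectors $\alpha$ with $c_\alpha\neq 0$ (so $S(0)=\emptyset$), and the Newton polytope is $N(p)=\mathrm{conv}(S(p))\subseteq\mathbb{R}^n$. For $T\subseteq\mathbb{R}^n$, $\mathrm{Proj}(p,T)$ is the polynomial obtained from $p$ by deleting all terms $c_\alpha x^\alpha$ with $\alpha\notin T\cap\mathbb{Z}^n$. Faces of a $d$-dimensional polytope are its faces of dimensions $0$ to $d-1$ (vertices, edges, ..., facets). A polynomial $p$ is a convex cover polynomial if there exist pairwise disjoint faces $F_1,\dots,F_u$ of $N(p)$ such that $S(p)\subseteq\bigcup_{i=1}^u F_i$. *)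

(* Defs.v *)
From HB Require Import structures.
From mathcomp Require Import all_boot all_order all_algebra.
From mathcomp Require Import mpoly.
From mathcomp Require Import boolp classical_sets reals convex.

Set Implicit Arguments.
Unset Strict Implicit.
Unset Printing Implicit Defensive.

Import Order.TTheory GRing.Theory Num.Theory.

Local Open Scope classical_set_scope.
Local Open Scope ring_scope.

Definition is_sos (R : realType) (n : nat) (p : {mpoly R[n]}) : Prop :=
  exists (s : nat) (q : 'I_s -> {mpoly R[n]}), p = \sum_(i < s) q i ^+ 2.

Definition expvec (R : realType) (n : nat) (m : 'X_{1..n}) : 'rV[R]_n :=
  \row_(j < n) (m j)%:R.

Definition support (R : realType) (n : nat) (p : {mpoly R[n]}) :
    set 'rV[R]_n :=
  [set expvec R m | m in [set m | m \in msupp p]].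

Definition conv (R : realType) (n : nat) (A : set 'rV[R]_n) : set 'rV[R]_n :=
  smallest (@convex_set R 'rV[R]_n) A.

Definition newton (R : realType) (n : nat) (p : {mpoly R[n]}) :
    set 'rV[R]_n :=
  conv (support p).

(* The integrality condition in "alpha \in T :&: Z^n" is automatic, since
   exponent vectors are integral. *)
Definition mproj (R : realType) (n : nat) (p : {mpoly R[n]})
    (T : set 'rV[R]_n) : {mpoly R[n]} :=
  \sum_(m <- msupp p | expvec R m \in T) p@_m *: 'X_[m].

(* d is the dimension of the affine hull of T: V below is the direction of
   that hull, the linear span of the differences of points of T. The empty
   set has no dimension. *)
Definition affine_dim (R : realType) (n : nat) (T : set 'rV[R]_n) (d : nat) :
    Prop :=
  T !=set0 /\
  exists V : {vspace 'rV[R]_n},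
    [/\ forall x y, T x -> T y -> x - y \in V,
        forall W : {vspace 'rV[R]_n},
          (forall x y, T x -> T y -> x - y \in W) -> (V <= W)%VS
      & \dim V = d].

Definition dot (R : realType) (n : nat) (c x : 'rV[R]_n) : R :=
  \sum_(j < n) c 0 j * x 0 j.

(* F is cut out of P by a valid inequality <c, x> <= b. The improper faces
   (P itself and the empty set) are excluded by the condition on dimensions,
   0 <= dim F <= dim P - 1. *)
Definition is_face (R : realType) (n : nat) (P F : set 'rV[R]_n) : Prop :=
  (exists (c : 'rV[R]_n) (b : R),
     (forall x, P x -> dot c x <= b) /\ F = P `&` [set x | dot c x = b]) /\
  (exists k d : nat, [/\ affine_dim F k, affine_dim P d & (k < d)%N]).

Definition convex_cover (R : realType) (n : nat) (p : {mpoly R[n]}) (u : nat)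
    (F : 'I_u -> set 'rV[R]_n) : Prop :=
  [/\ forall i, is_face (newton p) (F i),
      forall i j, i != j -> F i `&` F j = set0
    & support p `<=` \bigcup_i F i].

Definition convex_cover_poly (R : realType) (n : nat) (p : {mpoly R[n]}) :
    Prop :=
  exists (u : nat) (F : 'I_u -> set 'rV[R]_n), convex_cover p F.

(* Main.v *)
Require Import Defs.
From mathcomp Require Import all_boot all_order all_algebra.
From mathcomp Require Import mpoly.
From mathcomp Require Import boolp classical_sets reals.

Set Implicit Arguments.
Unset Strict Implicit.
Unset Printing Implicit Defensive.

Import Order.TTheory GRing.Theory Num.Theory.

Local Open Scope classical_set_scope.
Local Open Scope ring_scope.

(** A sum of squares may be cut down to any exposed face of its Newton
    polytope.  Let a linear functional c have maximum b on the exponents of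
    p = \sum_i q_i ^ 2, and grade monomials by their c-weight.  If d is the
    largest weight of a monomial in any of the q_i, the part of p of weight
    2d is the sum of the squares of the weight-d parts of the q_i
    ([mproj_level_sqr]); these are not all zero, and over an ordered field a
    sum of squares vanishes only when each square does ([sum_sqr_eq0]), so
    p has a monomial of weight 2d and 2d <= b ([weight_sos_le]).  Hence all
    weights in the q_i are at most b / 2, and the same grading argument at
    weight b / 2 writes the part of p on the hyperplane c = b as a sum of
    squares ([is_sos_mproj_level]).  On exponents of p this hyperplane and
    the face it exposes agree, which gives the direct implication.

    Conversely, pairwise disjoint faces that cover the support split p as
    the sum of its projections ([mproj_disjoint_cover]), and sums of squares
    are closed under addition. *)

Section Projection.
Variables (R : realType) (n : nat).
Implicit Types (p q : {mpoly R[n]}) (m : 'X_{1..n}) (T U : set 'rV[R]_n).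

Lemma mcoeff_mproj p T m :
  (mproj p T)@_m = if expvec R m \in T then p@_m else 0.
Proof.
rewrite /mproj raddf_sum /= big_mkcond /=.
rewrite (eq_bigr (fun k =>
    if k == m then if expvec R m \in T then p@_m else 0 else 0)); last first.
  move=> k _; rewrite mcoeffZ mcoeffX; case: eqP => [->|_].
    by rewrite mulr1.
  by rewrite mulr0 if_same.
have [mp|mNp] := boolP (m \in msupp p); last first.
  by rewrite memN_msupp_eq0 // if_same big1 // => k _; rewrite if_same.
rewrite (bigD1_seq m) ?msupp_uniq //= eqxx big1 ?addr0 // => k.
by case: eqVneq.
Qed.

Lemma mproj_sum I (r : seq I) (q : I -> {mpoly R[n]}) T :
  mproj (\sum_(i <- r) q i) T = \sum_(i <- r) mproj (q i) T.
Proof.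
apply/mpolyP => m; rewrite mcoeff_mproj !raddf_sum /=.
case: ifP => mT; last by rewrite big1 // => i _; rewrite mcoeff_mproj mT.
by apply: eq_bigr => i _; rewrite mcoeff_mproj mT.
Qed.

Lemma eq_mproj p T U :
    (forall m, m \in msupp p -> T (expvec R m) <-> U (expvec R m)) ->
  mproj p T = mproj p U.
Proof.
move=> TU; apply/mpolyP => m; rewrite !mcoeff_mproj.
have [mp|/memN_msupp_eq0 ->] := boolP (m \in msupp p); last by rewrite !if_same.
by congr (if _ then _ else _); apply/idP/idP; rewrite !inE => /(TU m mp).
Qed.

Lemma mproj_disjoint_cover p (u : nat) (F : 'I_u -> set 'rV[R]_n) :
    (forall i j, i != j -> F i `&` F j = set0) ->
    Defs.support p `<=` \bigcup_i F i ->
  p = \sum_(i < u) mproj p (F i).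
Proof.
move=> disjF covF; apply/mpolyP => m; rewrite raddf_sum /=.
under eq_bigr do rewrite mcoeff_mproj.
have [mp|/memN_msupp_eq0 ->] := boolP (m \in msupp p); last first.
  by rewrite big1 // => i _; rewrite if_same.
have [i _ Fi] : (\bigcup_i F i) (expvec R m) by apply: covF; exists m.
rewrite (bigD1 i) //= mem_set // big1 ?addr0 // => j ji.
case: ifP => // /set_mem Fj.
by have : (F j `&` F i) (expvec R m) by []; rewrite disjF.
Qed.

End Projection.

Section SumsOfSquares.
Variables (R : realType) (n : nat).
Implicit Types (p q : {mpoly R[n]}) (m : 'X_{1..n}) (c : 'rV[R]_n) (b d : R).

Lemma is_sos_sum (u : nat) (p : 'I_u -> {mpoly R[n]}) :
  (forall i, is_sos (p i)) -> is_sos (\sum_(i < u) p i).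
Proof.
move=> sosp; elim/big_ind: _ => [|x y [s [f ->]] [t [g ->]]|i _]; last 1 first.
- exact: sosp.
- by exists 0, (fun=> 0); rewrite big_ord0.
exists (s + t)%N, (fun k => match split k with inl i => f i | inr j => g j end).
rewrite big_split_ord /=; congr (_ + _); apply: eq_bigr => i _.
  by rewrite (unsplitK (inl i)).
by rewrite (unsplitK (inr i)).
Qed.

(** Leading terms of squares cannot cancel: at twice the largest leading
    monomial M, the coefficient of the sum is a sum of squares of reals. *)
Lemma sum_sqr_eq0 (s : nat) (q : 'I_s -> {mpoly R[n]}) :
  \sum_(i < s) q i ^+ 2 = 0 -> forall i, q i = 0.
Proof.
move=> q0 i0; apply/eqP/negPn/negP => qi0.
case: (@Order.TotalTheory.arg_maxP _ _ _ i0 (fun i => q i != 0)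
  (fun i => mlead (q i)) qi0) => k qk kmax.
have leM i : (mlead (q i) <= mlead (q k))%O.
  by have [->|/kmax //] := eqVneq (q i) 0; rewrite mlead0 le0x.
have /eqP := congr1 (mcoeff (mlead (q k) + mlead (q k))%MM) q0.
rewrite mcoeff0 raddf_sum /=.
under eq_bigr do rewrite expr2 mleadcMW // -expr2.
rewrite psumr_eq0 => [/allP/(_ k)|i _]; last exact: sqr_ge0.
by rewrite mem_index_enum sqrf_eq0 mleadc_eq0 (negPf qk) => /(_ isT).
Qed.

Lemma dot_expvecD c m1 m2 :
  dot c (expvec R (m1 + m2)%MM) = dot c (expvec R m1) + dot c (expvec R m2).
Proof.
by rewrite -big_split; apply: eq_bigr => j _; rewrite !mxE mnmDE natrD mulrDr.
Qed.

(** A product of two monomials of weight at most d has weight d + d only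
    when both factors have weight exactly d. *)
Lemma mproj_level_sqr c d q :
    (forall m, m \in msupp q -> dot c (expvec R m) <= d) ->
  mproj (q ^+ 2) [set x | dot c x = d + d] =
  mproj q [set x | dot c x = d] ^+ 2.
Proof.
move=> qd; apply/mpolyP => m.
have qd' k : k \in msupp q -> d < dot c (expvec R k) = false.
  by move=> /qd; rewrite leNgt => /negbTE.
rewrite mcoeff_mproj !expr2 !mcoeffM.
case: ifPn => [/set_mem /= wm|/negP wm]; last first.
  symmetry; apply: big1 => -[k1 k2] /= /eqP mE; rewrite !mcoeff_mproj.
  case: ifPn => [/set_mem /= w1|]; last by rewrite mul0r.
  case: ifPn => [/set_mem /= w2|]; last by rewrite mulr0.
  by case: wm; apply/mem_set; rewrite /= mE dot_expvecD w1 w2.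
apply: eq_bigr => -[k1 k2] /= /eqP mE; rewrite !mcoeff_mproj.
have [k1q|/memN_msupp_eq0 ->] := boolP (val k1 \in msupp q); last first.
  by rewrite if_same !mul0r.
have [k2q|/memN_msupp_eq0 ->] := boolP (val k2 \in msupp q); last first.
  by rewrite if_same !mulr0.
have wE : dot c (expvec R k1) + dot c (expvec R k2) = d + d.
  by rewrite -dot_expvecD -mE.
have w1 : dot c (expvec R (val k1)) = d.
  apply/le_anti; rewrite qd //= -(lerD2r d) -wE lerD2l; exact: qd.
have w2 : dot c (expvec R (val k2)) = d by move: wE; rewrite w1 => /addrI.
by rewrite !mem_set.
Qed.

(** Otherwise the largest weight d in the q_i exceeds b / 2, the sum has no
    part of weight d + d, and the weight-d parts of the q_i all vanish, against
    the choice of d.  For all c together this says that the Newton polytope of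
    each q_i lies in half the one of the sum of squares. *)
Lemma weight_sos_le c b (s : nat) (q : 'I_s -> {mpoly R[n]}) :
    (forall m, m \in msupp (\sum_(i < s) q i ^+ 2) ->
       dot c (expvec R m) <= b) ->
  forall i m, m \in msupp (q i) -> dot c (expvec R m) <= b / 2.
Proof.
move=> pb i0 m0 m0q.
pose x0 : {i : 'I_s & seq_sub (msupp (q i))} := Tagged _ (SeqSub m0q).
pose w (x : {i : 'I_s & seq_sub (msupp (q i))}) :=
  dot c (expvec R (ssval (tagged x))).
case: (@Order.TotalTheory.arg_maxP _ _ _ x0 predT w isT) => -[k M] _ kmax.
pose d := dot c (expvec R (ssval M)).
have qd i m : m \in msupp (q i) -> dot c (expvec R m) <= d.
  by move=> mq; exact: (kmax (Tagged _ (SeqSub mq)) isT).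
apply: le_trans (qd _ _ m0q) _; rewrite ler_pdivlMr // mulr_natr mulr2n.
rewrite leNgt; apply/negP => bd.
have top0 : \sum_(i < s) mproj (q i) [set x | dot c x = d] ^+ 2 = 0.
  under eq_bigr => i _ do rewrite -(mproj_level_sqr (@qd i)).
  rewrite -mproj_sum; apply/mpolyP => m; rewrite mcoeff_mproj mcoeff0.
  case: ifP => // /set_mem /= wm; apply: memN_msupp_eq0.
  by apply/negP => /pb; rewrite wm leNgt bd.
have /(congr1 (mcoeff (ssval M)))/eqP := sum_sqr_eq0 top0 k.
by rewrite mcoeff_mproj mem_set // mcoeff0 mcoeff_eq0 (ssvalP M).
Qed.

Lemma is_sos_mproj_level c b p :
    (forall m, m \in msupp p -> dot c (expvec R m) <= b) ->
  is_sos p -> is_sos (mproj p [set x | dot c x = b]).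
Proof.
move=> pb [s [q pE]]; rewrite pE in pb *.
exists s, (fun i => mproj (q i) [set x | dot c x = b / 2]).
rewrite mproj_sum [in LHS](splitr b); apply: eq_bigr => i _.
by apply: mproj_level_sqr; exact: weight_sos_le pb i.
Qed.

Lemma newton_expvec p m : m \in msupp p -> newton p (expvec R m).
Proof. by move=> mp; apply: sub_gen_smallest; exists m. Qed.

Lemma is_sos_mproj_face p F :
  is_face (newton p) F -> is_sos p -> is_sos (mproj p F).
Proof.
move=> [[c [b [cb ->]]] _] sosp.
rewrite (@eq_mproj _ _ _ _ [set x | dot c x = b]).
  by apply: is_sos_mproj_level => // m /newton_expvec/cb.
by move=> m /newton_expvec Nm; split=> [[_ wb]|wb]; last split.
Qed.

End SumsOfSquares.

Theorem theorem2 (R : realType) (n : nat) (p : {mpoly R[n]})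
    (hp : convex_cover_poly p)
    (u : nat) (F : 'I_u -> set 'rV[R]_n) (hF : convex_cover p F) :
  is_sos p <-> (forall i : 'I_u, is_sos (mproj p (F i))).
Proof.
case: hF => faceF disjF covF; split=> [sosp i|sosF].
  exact: is_sos_mproj_face (faceF i) sosp.
by rewrite (mproj_disjoint_cover disjF covF); exact: is_sos_sum.
Qed.
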